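(* Let $R$ be a ring and let $A$ be a subring retract of $R$. If $R$ is an arithmetical ring, then $A$ is an arithmetical ring.
   Context: All rings are commutative with identity and all modules are unital. Subring retract: for rings $A \subseteq R$ ($A$ a subring of $R$), $A$ is a subring retract (or module retract) of $R$ if there is an $A$-module homomorphism $\phi : R \to A$ with $\phi(a) = a$ for all $a \in A$ ($\phi$ need not be a ring homomorphism). Arithmetical ring: a ring is arithmetical if every finitely generated ideal is locally principal, i.e. its localization at each maximal ideal is a principal ideal. *)

(* Defs.v *)
From HB Require Import structures.
From mathcomp Require Import all_boot all_algebra.
From mathcomp Require Import generic_quotient ring.
From mathcomp Require Import boolp classical_sets.
Set Implicit Arguments.
Unset Strict Implicit.
Unset Printing Implicit Defensive.
Import GRing.Theory.
Local Open Scope ring_scope.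
Local Open Scope classical_set_scope.
Local Open Scope quotient_scope.

(* Rings are [comPzRingType]s, so that the zero ring is allowed; the ideals of
   [ring_quotient] are decidable, proper and live in nontrivial rings, hence
   the set-based definitions below. *)

Section Ideals.
Variable R : comPzRingType.
Implicit Types (I J M X : set R).

Definition is_ideal I : Prop :=
  [/\ I 0, forall x y, I x -> I y -> I (x + y)
    & forall a x, I x -> I (a * x)].

Definition ideal_gen X : set R := smallest is_ideal X.

Definition fg_ideal I : Prop := exists s : seq R, I = ideal_gen [set` s].

Definition principal_ideal I : Prop := exists x : R, I = ideal_gen [set x].

Definition maximal_ideal M : Prop :=
  [/\ is_ideal M, ~ M 1
    & forall J, is_ideal J -> M `<=` J -> J = M \/ J = setT].

Lemma ideal_gen_ideal X : is_ideal (ideal_gen X).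
Proof.
split=> [J [[] //]|x y hx hy J hJ|a x hx J hJ].
- by case: (hJ) => -[_ hD _] _; apply: hD; [exact: hx | exact: hy].
- by case: (hJ) => -[_ _ hM] _; apply: hM; exact: hx.
Qed.

Lemma principal_genE (x : R) : ideal_gen [set x] = [set a * x | a in setT].
Proof.
apply/seteqP; split=> [y|_ [a _ <-]]; last first.
  by case: (ideal_gen_ideal [set x]) => _ _; apply; exact: sub_gen_smallest.
apply; split=> [|_ ->]; last by exists 1; rewrite ?mul1r.
split; first by exists 0; rewrite ?mul0r.
- by move=> _ _ [a _ <-] [b _ <-]; exists (a + b); rewrite ?mulrDl.
- by move=> a _ [b _ <-]; exists (a * b); rewrite ?mulrA.
Qed.

Lemma maximal_ideal_prime M : maximal_ideal M ->
  forall x y, M (x * y) -> M x \/ M y.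
Proof.
move=> [[M0 MD MM] M1 Mmax] x y Mxy.
have [Mx|nMx] := pselect (M x); [by left | right].
pose J := [set z | exists m a, M m /\ z = m + a * x].
have hJ : is_ideal J.
  split; first by exists 0, 0; rewrite mul0r addr0.
  - move=> _ _ [m [a [Mm ->]]] [n [b [Mn ->]]]; exists (m + n), (a + b).
    by split; [exact: MD | ring].
  - move=> c _ [m [a [Mm ->]]]; exists (c * m), (c * a).
    by split; [exact: MM | ring].
have MJ : M `<=` J by move=> m Mm; exists m, 0; rewrite mul0r addr0.
case: (Mmax J hJ MJ) => JE.
  by case: nMx; rewrite -JE; exists 0, 1; rewrite mul1r add0r.
have [m [a [Mm E]]] : J 1 by rewrite JE.
have -> : y = y * m + a * (x * y) by rewrite -[LHS]mul1r E; ring.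
by apply: MD; apply: MM.
Qed.

End Ideals.

Record maxIdeal (R : comPzRingType) :=
  MaxIdeal { max_set :> set R; max_setP : maximal_ideal max_set }.

(* S^-1 R, for S a multiplicative subset: pairs (a, s) with s in S, where
   (a, s) ~ (b, t) iff u * (a * t - b * s) = 0 for some u in S. *)
Module Localization.
Section Localization.
Variables (R : comPzRingType) (S : mulrClosed R).

Definition den := {s : R | s \in S}.
Definition pre := (R * den)%type.
Implicit Types (s t : den) (x y z : pre).

Definition den1 : den := Sub 1 (rpred1 S).
Definition denM s t : den := Sub (val s * val t) (rpredM (valP s) (valP t)).

Definition eqv x y : bool :=
  `[< exists2 u, u \in S & u * (x.1 * val y.2 - y.1 * val x.2) = 0 >].

Lemma eqv_refl : reflexive eqv.
Proof. by move=> x; apply/asboolP; exists 1; rewrite ?rpred1 // subrr mulr0. Qed.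

Lemma eqv_sym : symmetric eqv.
Proof.
move=> x y; apply/asboolP/asboolP => -[u uS E]; exists u => //;
  by rewrite -opprB mulrN E oppr0.
Qed.

Lemma eqv_trans : transitive eqv.
Proof.
move=> y x z /asboolP[u uS E] /asboolP[v vS F]; apply/asboolP.
exists (u * v * val y.2); first by do 2?apply: rpredM => //; exact: (valP y.2).
have -> : u * v * val y.2 * (x.1 * val z.2 - z.1 * val x.2) =
  v * val z.2 * (u * (x.1 * val y.2 - y.1 * val x.2)) +
  u * val x.2 * (v * (y.1 * val z.2 - z.1 * val y.2)) by ring.
by rewrite E F !mulr0 addr0.
Qed.

Canonical eqv_equiv := EquivRel eqv eqv_refl eqv_sym eqv_trans.

Definition type := {eq_quot eqv}.
#[export] HB.instance Definition _ : EqQuotient _ eqv type := EqQuotient.on type.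
#[export] HB.instance Definition _ := Choice.on type.

Lemma pi_eqP x y : \pi_type x = \pi_type y <->
  exists2 u, u \in S & u * (x.1 * val y.2 - y.1 * val x.2) = 0.
Proof.
split; first by move/eqmodP => /asboolP.
by move=> h; apply/eqmodP/asboolP.
Qed.

Definition add_pre x y : pre := (x.1 * val y.2 + y.1 * val x.2, denM x.2 y.2).
Definition opp_pre x : pre := (- x.1, x.2).
Definition mul_pre x y : pre := (x.1 * y.1, denM x.2 y.2).

Definition zero : type := \pi_type (0, den1).
Definition one : type := \pi_type (1, den1).
Definition add (p q : type) : type := \pi_type (add_pre (repr p) (repr q)).
Definition opp (p : type) : type := \pi_type (opp_pre (repr p)).
Definition mul (p q : type) : type := \pi_type (mul_pre (repr p) (repr q)).

Lemma addE x y : add (\pi_type x) (\pi_type y) = \pi_type (add_pre x y).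
Proof.
have /pi_eqP[u uS E] := reprK (\pi_type x).
have /pi_eqP[v vS F] := reprK (\pi_type y).
apply/pi_eqP; exists (u * v); first exact: rpredM.
rewrite /add_pre /=; set x' := repr _ in E *; set y' := repr _ in F *.
have -> : u * v * ((x'.1 * val y'.2 + y'.1 * val x'.2) * (val x.2 * val y.2) -
    (x.1 * val y.2 + y.1 * val x.2) * (val x'.2 * val y'.2)) =
  v * val y'.2 * val y.2 * (u * (x'.1 * val x.2 - x.1 * val x'.2)) +
  u * val x'.2 * val x.2 * (v * (y'.1 * val y.2 - y.1 * val y'.2)) by ring.
by rewrite E F !mulr0 addr0.
Qed.

Lemma oppE x : opp (\pi_type x) = \pi_type (opp_pre x).
Proof.
have /pi_eqP[u uS E] := reprK (\pi_type x).
apply/pi_eqP; exists u => //; rewrite /opp_pre /=.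
by rewrite !mulNr -opprD mulrN E oppr0.
Qed.

Lemma mulE x y : mul (\pi_type x) (\pi_type y) = \pi_type (mul_pre x y).
Proof.
have /pi_eqP[u uS E] := reprK (\pi_type x).
have /pi_eqP[v vS F] := reprK (\pi_type y).
apply/pi_eqP; exists (u * v); first exact: rpredM.
rewrite /mul_pre /=; set x' := repr _ in E *; set y' := repr _ in F *.
have -> : u * v * (x'.1 * y'.1 * (val x.2 * val y.2) -
    x.1 * y.1 * (val x'.2 * val y'.2)) =
  v * y'.1 * val y.2 * (u * (x'.1 * val x.2 - x.1 * val x'.2)) +
  u * val x'.2 * x.1 * (v * (y'.1 * val y.2 - y.1 * val y'.2)) by ring.
by rewrite E F !mulr0 addr0.
Qed.

Lemma pi_ext x y : x.1 * val y.2 = y.1 * val x.2 -> \pi_type x = \pi_type y.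
Proof. by move=> E; apply/pi_eqP; exists 1; rewrite ?rpred1 // E subrr mulr0. Qed.

Lemma addA : associative add.
Proof.
elim/quotW=> x; elim/quotW=> y; elim/quotW=> z.
by rewrite (addE y z) (addE x y) !addE; apply: pi_ext => /=; ring.
Qed.

Lemma addC : commutative add.
Proof.
by elim/quotW=> x; elim/quotW=> y; rewrite !addE; apply: pi_ext => /=; ring.
Qed.

Lemma add0 : left_id zero add.
Proof. by elim/quotW=> x; rewrite addE; apply: pi_ext => /=; ring. Qed.

Lemma addN : left_inverse zero opp add.
Proof. by elim/quotW=> x; rewrite oppE addE; apply: pi_ext => /=; ring. Qed.

#[export] HB.instance Definition _ := GRing.isZmodule.Build type addA addC add0 addN.

Lemma mulA : associative mul.
Proof.
elim/quotW=> x; elim/quotW=> y; elim/quotW=> z.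
by rewrite (mulE y z) (mulE x y) !mulE; apply: pi_ext => /=; ring.
Qed.

Lemma mulC : commutative mul.
Proof.
by elim/quotW=> x; elim/quotW=> y; rewrite !mulE; apply: pi_ext => /=; ring.
Qed.

Lemma mul1 : left_id one mul.
Proof. by elim/quotW=> x; rewrite mulE; apply: pi_ext => /=; ring. Qed.

Lemma mulDl : left_distributive mul add.
Proof.
elim/quotW=> x; elim/quotW=> y; elim/quotW=> z.
by rewrite (addE x y) (mulE x z) (mulE y z) mulE addE; apply: pi_ext => /=; ring.
Qed.

#[export] HB.instance Definition _ :=
  GRing.Zmodule_isComPzRing.Build type mulA mulC mul1 mulDl.

Definition frac (a : R) (s : den) : type := \pi_type (a, s).

Lemma frac_eqP (a b : R) s t : frac a s = frac b t <->
  exists2 u, u \in S & u * (a * val t - b * val s) = 0.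
Proof. exact: pi_eqP. Qed.

Lemma fracW (P : type -> Prop) : (forall a s, P (frac a s)) -> forall p, P p.
Proof. by move=> h; elim/quotW=> -[a s]; exact: h. Qed.

Lemma fracD (a b : R) s t :
  frac a s + frac b t = frac (a * val t + b * val s) (denM s t).
Proof. exact: addE. Qed.

Lemma fracM (a b : R) s t : frac a s * frac b t = frac (a * b) (denM s t).
Proof. exact: mulE. Qed.

Definition of_ring (a : R) : type := frac a den1.

Fact of_ring_zmod_morphism : zmod_morphism of_ring.
Proof.
move=> a b; apply: etrans (esym (etrans (congr1 (add _) (oppE _)) (addE _ _))).
by apply: pi_ext => /=; ring.
Qed.

Fact of_ring_monoid_morphism : monoid_morphism of_ring.
Proof. by split=> // a b; rewrite fracM; apply: pi_ext => /=; ring. Qed.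

#[export] HB.instance Definition _ :=
  GRing.isZmodMorphism.Build R type of_ring of_ring_zmod_morphism.
#[export] HB.instance Definition _ :=
  GRing.isMonoidMorphism.Build R type of_ring of_ring_monoid_morphism.

Lemma frac_denK (a : R) s : frac a s * of_ring (val s) = of_ring a.
Proof. by rewrite fracM; apply: pi_ext => /=; ring. Qed.

(* S^-1 I, as a subset of S^-1 R. *)
Definition ideal (I : set R) : set type :=
  [set p | exists a s, I a /\ p = frac a s].

Lemma idealE (I : set R) : is_ideal I -> ideal I = ideal_gen (of_ring @` I).
Proof.
move=> [I0 ID IM]; apply/seteqP; split=> [_ [a [s [Ia ->]]]|].
  have -> : frac a s = frac 1 s * of_ring a.
    by rewrite fracM; apply: pi_ext => /=; ring.
  case: (ideal_gen_ideal (of_ring @` I)) => _ _; apply.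
  by apply: sub_gen_smallest; exists a.
move=> p; apply; split; last by move=> _ [a Ia <-]; exists a, den1.
split; first by exists 0, den1.
- move=> _ _ [a [s [Ia ->]]] [b [t [Ib ->]]].
  exists (a * val t + b * val s), (denM s t); split; last exact: fracD.
  by apply: ID; rewrite mulrC; apply: IM.
- elim/fracW => b t _ [a [s [Ia ->]]]; exists (b * a), (denM t s).
  by split; [exact: IM | exact: fracM].
Qed.

End Localization.
Module Exports. HB.reexport. End Exports.
End Localization.
Export Localization.Exports.

Section MaximalComplement.
Variables (R : comPzRingType) (M : maxIdeal R).

Definition max_compl : {pred R} := fun x => x \notin max_set M.

Lemma max_complP (x : R) : reflect (~ max_set M x) (x \in max_compl).
Proof. by rewrite unfold_in; apply: (iffP idP); rewrite notin_setE. Qed.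

Fact max_compl_mulr_closed : mulr_closed max_compl.
Proof.
split; first by apply/max_complP; case: (max_setP M).
move=> x y /max_complP nx /max_complP ny; apply/max_complP.
by case/(maximal_ideal_prime (max_setP M)).
Qed.

HB.instance Definition _ :=
  GRing.isMulClosed.Build R max_compl max_compl_mulr_closed.

End MaximalComplement.

Notation local_ring M := (Localization.type (max_compl M)).

Definition local_ideal (R : comPzRingType) (M : maxIdeal R) (I : set R) :
    set (local_ring M) :=
  @Localization.ideal R (max_compl M) I.
Arguments local_ideal {R} M I _.

Definition arithmetical (R : comPzRingType) : Prop :=
  forall I : set R, fg_ideal I ->
  forall M : maxIdeal R, principal_ideal (local_ideal M I).

(* [A] is the subring [P] of [R], with inclusion [val : A -> R]; [R] is an
   [A]-module through [val]. *)
Definition subring_retract (R : comPzRingType) (P : {pred R})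
    (A : subComPzRingType P) : Prop :=
  exists phi : {additive R -> A},
    (forall (a : A) (r : R), phi (val a * r) = a * phi r) /\
    (forall a : A, phi (val a) = a).

(* Main.v *)
(** A ring is arithmetical iff for all [a] and [b] there are [x + y = 1] with
    [x a] in [(b)] and [y b] in [(a)]: this says that, at each maximal ideal,
    one of [a], [b] divides the other.  Such a relation between two elements
    of [A] that holds in [R] is carried into [A] by the [A]-linear retraction,
    which fixes [1]. *)
Require Import Defs.
From mathcomp Require Import all_boot all_algebra.
From mathcomp Require Import ring boolp classical_sets.
Set Implicit Arguments.
Unset Strict Implicit.
Unset Printing Implicit Defensive.
Import GRing.Theory.
Local Open Scope ring_scope.
Local Open Scope classical_set_scope.

Section Ideals.
Variable R : comPzRingType.
Implicit Types (a b g x y z : R) (I : set R) (M : maxIdeal R).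

Lemma ideal_gen_sub X I : is_ideal I -> X `<=` I -> ideal_gen X `<=` I.
Proof. by move=> hI XI x; apply. Qed.

Lemma proper_ideal_sub_maximal I : is_ideal I -> ~ I 1 ->
  exists M, I `<=` max_set M.
Proof.
move=> hI I1; have [I0 ID IM] := hI.
(* Zorn's lemma is applied to the sets [X] with [I `|` X] a proper ideal, so
   that the union of the empty chain qualifies. *)
pose proper_over (X : set R) := is_ideal (I `|` X) /\ ~ (I `|` X) 1.
have [F subF totF|X [[hX X1] Xmax]] := @Zorn_bigcup _ proper_over.
  have sup (X : set R) : F X -> I `|` X `<=` I `|` \bigcup_(Y in F) Y.
    by move=> FX x [|Xx]; [left | right; exists X].
  split; last by case=> // -[X FX X1]; case: (subF X FX) => _; apply; right.
  split; first by left.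
  - move=> x y [Ix|[X FX Xx]] [Iy|[Y FY Yy]].
    + by left; apply: ID.
    + apply: (sup Y) => //; case: (subF Y FY) => -[_ + _] _.
      by apply; [left | right].
    + apply: (sup X) => //; case: (subF X FX) => -[_ + _] _.
      by apply; [right | left].
    + have [XY|YX] := totF X Y FX FY.
      * apply: (sup Y) => //; case: (subF Y FY) => -[_ + _] _.
        by apply; right => //; exact: XY.
      * apply: (sup X) => //; case: (subF X FX) => -[_ + _] _.
        by apply; right => //; exact: YX.
  - move=> a x [Ix|[X FX Xx]]; first by left; apply: IM.
    by apply: (sup X) => //; case: (subF X FX) => -[_ _ +] _; apply; right.
have maxX : maximal_ideal (I `|` X).
  split=> // J hJ XJ; have IJ : I `|` J = J.
    by apply/setUidPr => x Ix; apply: XJ; left.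
  have [J1|J1] := pselect (J 1).
    right; apply/seteqP; split=> // x _; rewrite -[x]mulr1.
    by case: hJ => _ _; apply.
  left; apply/seteqP; split=> // x Jx; apply: contrapT => nXx.
  (* Otherwise [J] would strictly contain [X] and still satisfy [proper_over], against the
     maximality of [X]. *)
  case: (Xmax J); last by rewrite /proper_over IJ.
  split; first by move=> y Xy; apply: XJ; right.
  by move=> /(_ x Jx) Xx; apply: nXx; right.
by exists (MaxIdeal maxX); left.
Qed.

Lemma max_complM M x y :
  ~ max_set M x -> ~ max_set M y -> ~ max_set M (x * y).
Proof. by move=> nx ny /(maximal_ideal_prime (max_setP M)) []. Qed.

(** For fixed [a] and [b] the equations are linear in the unknowns [x], [y], [u], [v], so a linear
    map can transport a solution. *)
Definition pairwise_bezout :=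
  forall a b, exists x y u v, [/\ x + y = 1, x * a = u * b & y * b = v * a].

Lemma ideal_gen_pair a b z :
  ideal_gen [set` [:: a; b]] z -> exists c d, z = c * a + d * b.
Proof.
move: z; apply: ideal_gen_sub => [|x].
  split; first by exists 0, 0; rewrite !mul0r addr0.
  - by move=> _ _ [c [d ->]] [c' [d' ->]]; exists (c + c'), (d + d'); ring.
  - by move=> e _ [c [d ->]]; exists (e * c), (e * d); ring.
rewrite /= !inE => /orP[] /eqP ->; first by exists 1, 0; ring.
by exists 0, 1; ring.
Qed.

(** Clearing denominators: [t] is the product of both denominators and the multiplier that witnesses
    equality of fractions. *)
Lemma local_multiple M a z (s : Localization.den (max_compl M))
    (p : local_ring M) :
  Localization.of_ring (max_compl M) a = p * Localization.frac z s ->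
  exists t c, ~ max_set M t /\ t * a = c * z.
Proof.
elim/Localization.fracW: p => p t; rewrite Localization.fracM.
move=> /Localization.frac_eqP[u /max_complP uM] /= E.
exists (u * (sval t * sval s)), (u * p); split.
  apply: max_complM => //; apply: max_complM.
    exact/max_complP/(valP t).
  exact/max_complP/(valP s).
by apply/eqP; rewrite -subr_eq0; apply/eqP; rewrite -E; ring.
Qed.

(** At [M] the ideal of [a] and [b] has a generator [z / s] with [z = c * a + d * b], and up to
    units [a] is [p * z] and [b] is [q * z]. If [p] or [q] is a unit at [M], it can be cancelled; if
    neither is, [z] vanishes at [M], as in Nakayama's lemma. *)
Lemma arithmetical_local_total M a b : arithmetical R ->
  exists2 t, ~ max_set M t &
    (exists u, t * a = u * b) \/ (exists v, t * b = v * a).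
Proof.
pose I := ideal_gen [set` [:: a; b]].
move=> /(_ I) /(_ (ex_intro _ _ erefl) M) [g]; rewrite principal_genE => Eg.
have Ig : local_ideal M I g by rewrite Eg; exists 1; rewrite ?mul1r.
case: Ig => z [s [Iz gE]]; have [c [d zE]] := ideal_gen_pair Iz.
have mult x : x \in [:: a; b] -> exists t e, ~ max_set M t /\ t * x = e * z.
  move=> xab; have : local_ideal M I (Localization.of_ring (max_compl M) x).
    exists x, (Localization.den1 _); split=> //.
    exact: (@sub_gen_smallest _ _ [set` [:: a; b]]).
  by rewrite Eg gE => -[p _ E]; apply: (@local_multiple M x z s p).
have [sa [p [saM Ea]]] : exists t e, ~ max_set M t /\ t * a = e * z.
  by apply: mult; rewrite !inE eqxx.
have [sb [q [sbM Eb]]] : exists t e, ~ max_set M t /\ t * b = e * z.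
  by apply: mult; rewrite !inE eqxx orbT.
(* Both [p * sb * b] and [q * sa * a] equal [p * q * z]. *)
have [pM|pM] := pselect (max_set M p); last first.
  exists (p * sb); first exact: max_complM.
  by right; exists (q * sa); rewrite -!mulrA Ea Eb; ring.
have [qM|qM] := pselect (max_set M q); last first.
  exists (q * sa); first exact: max_complM.
  by left; exists (p * sb); rewrite -!mulrA Ea Eb; ring.
(* [e] is a unit at [M] that annihilates the generator, so that [a] vanishes
   at [M]. *)
pose e := sa * sb - (c * sb * p + d * sa * q).
have ez : e * z = 0.
  have : sa * sb * z = c * sb * (p * z) + d * sa * (q * z).
    by rewrite -Ea -Eb {1}zE; ring.
  by rewrite /e mulrBl => ->; ring.
have [[M0 MD MM] _ _] := max_setP M.
have eM : ~ max_set M e.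
  move=> eM; apply: (max_complM saM sbM).
  have -> : sa * sb = e + (c * sb * p + d * sa * q) by rewrite /e; ring.
  by apply: (MD) => //; apply: (MD); apply: MM.
exists (e * sa); first exact: max_complM.
left; exists 0.
have -> : e * sa * a = p * (e * z) by rewrite -mulrA Ea; ring.
by rewrite ez; ring.
Qed.

(** Local to global: the possible sums [x + y] form an ideal [J]. Were it proper, it would lie in
    some maximal [M], but divisibility at [M] puts an element [t] outside [M] into [J], with [x] or
    [y] zero. *)
Lemma arithmetical_pairwise_bezout : arithmetical R -> pairwise_bezout.
Proof.
move=> arR a b.
pose J := [set z | exists x y u v,
  [/\ x + y = z, x * a = u * b & y * b = v * a]].
change (J 1); apply: contrapT => J1.
have hJ : is_ideal J.
  split; first by exists 0, 0, 0, 0; split; ring.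
  - move=> _ _ [x [y [u [v [<- E F]]]]] [x' [y' [u' [v' [<- E' F']]]]].
    exists (x + x'), (y + y'), (u + u'), (v + v').
    by split; rewrite ?mulrDl ?E ?F ?E' ?F' //; ring.
  - move=> c _ [x [y [u [v [<- E F]]]]].
    exists (c * x), (c * y), (c * u), (c * v).
    by split; rewrite -?mulrA ?E ?F //; ring.
have [M JM] := proper_ideal_sub_maximal hJ J1.
have [t tM [[u E]|[v E]]] := arithmetical_local_total M a b arR.
- by apply: tM; apply: JM; exists t, 0, u, 0; split; rewrite ?E; ring.
- by apply: tM; apply: JM; exists 0, t, 0, v; split; rewrite ?E; ring.
Qed.

(** Since [x + y = 1], one of [x] and [y] lies outside [M] and serves as [t]. *)
Lemma pairwise_bezout_local_total M a b : pairwise_bezout ->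
  exists2 t, ~ max_set M t &
    (exists u, t * a = u * b) \/ (exists v, t * b = v * a).
Proof.
move=> /(_ a b) [x [y [u [v [xy E F]]]]].
have [[_ MD _] M1 _] := max_setP M.
have [xM|xM] := pselect (max_set M x).
  exists y; last by right; exists v.
  by move=> yM; apply: M1; rewrite -xy; apply: MD.
by exists x => //; left; exists u.
Qed.

(** The preimage in [R] of the principal ideal generated by [g / 1] in the local ring at [M],
    written without fractions. *)
Definition local_multiples M g : set R :=
  [set x | exists t v, ~ max_set M t /\ t * x = v * g].

Lemma local_multiples_ideal M g : is_ideal (local_multiples M g).
Proof.
have [_ M1 _] := max_setP M; split.
- by exists 1, 0; split; [|ring].
- move=> x y [s [u [sM E]]] [t [v [tM F]]].
  exists (s * t), (t * u + s * v); split; first exact: max_complM.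
  have -> : s * t * (x + y) = t * (s * x) + s * (t * y) by ring.
  by rewrite E F; ring.
- move=> a x [s [u [sM E]]]; exists s, (a * u); split=> //.
  by rewrite mulrCA E mulrA.
Qed.

Lemma local_multiples_trans M g h x :
  local_multiples M h g -> local_multiples M g x -> local_multiples M h x.
Proof.
move=> [s [u [sM E]]] [t [v [tM F]]].
exists (s * t), (v * u); split; first exact: max_complM.
by rewrite -mulrA F mulrCA E mulrA.
Qed.

Lemma local_multiples_refl M g : local_multiples M g g.
Proof. by exists 1, 1; split; [case: (max_setP M)|]. Qed.

(** Divisibility at [M] is a total preorder, so a finite list has a member dividing all the others;
    the induction keeps [g] or replaces it by [a]. The empty list takes [0]. *)
Lemma pairwise_bezout_local_generator M (s : seq R) : pairwise_bezout ->
  exists2 g, ideal_gen [set` s] g & [set` s] `<=` local_multiples M g.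
Proof.
move=> bezR; elim: s => [|a s [g sg IH]].
  by exists 0 => [|x]; [case: (ideal_gen_ideal [set` [::] : seq R])|].
have sas : ideal_gen [set` s] `<=` ideal_gen [set` a :: s].
  apply: ideal_gen_sub; first exact: ideal_gen_ideal.
  move=> x /= xs; apply: sub_gen_smallest.
  by rewrite /= inE xs orbT.
have [t tM [[u E]|[v E]]] := pairwise_bezout_local_total M a g bezR.
  exists g; first exact: sas.
  move=> x; rewrite /= inE => /orP[/eqP->|xs]; last exact: IH.
  by exists t, u.
exists a; first by apply: sub_gen_smallest; rewrite /= inE eqxx.
move=> x; rewrite /= inE => /orP[/eqP->|xs].
  exact: local_multiples_refl.
apply: (@local_multiples_trans M g); last exact: IH.
by exists t, v.
Qed.

Lemma pairwise_bezout_arithmetical : pairwise_bezout -> arithmetical R.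
Proof.
move=> bezR _ [s ->] M.
have [g sg gen] := pairwise_bezout_local_generator M s bezR.
have sub := ideal_gen_sub (local_multiples_ideal M g) gen.
exists (Localization.of_ring _ g).
rewrite /local_ideal (Localization.idealE _ (ideal_gen_ideal _)).
apply/seteqP; split.
  apply: smallest_sub; first exact: ideal_gen_ideal.
  rewrite principal_genE => _ [x /sub [t [v [tM E]]] <-].
  have tS : t \in max_compl M by apply/max_complP.
  (* From [t * x = v * g] follows [x / 1 = (v / t) * (g / 1)]. *)
  exists (Localization.frac v (exist _ t tS)) => //.
  rewrite Localization.fracM; apply: Localization.pi_ext => /=.
  by rewrite -E; ring.
apply: smallest_sub; first exact: ideal_gen_ideal.
by move=> _ ->; apply: sub_gen_smallest; exists g.
Qed.

End Ideals.

Theorem theorem2p5 (R : comPzRingType) (P : {pred R})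
  (A : subComPzRingType P) :
  subring_retract A -> arithmetical R -> arithmetical A.
Proof.
move=> [phi [phiM phiK]] /arithmetical_pairwise_bezout bezR.
apply: pairwise_bezout_arithmetical => a b.
have [x [y [u [v [xy E F]]]]] := bezR (val a) (val b).
have phiMr (r : R) c : phi (r * val c) = phi r * c by rewrite mulrC phiM mulrC.
(* In each product one factor is [val a] or [val b], so linearity of [phi] over [A] suffices to
   carry the equations over. *)
exists (phi x), (phi y), (phi u), (phi v); split.
- by rewrite -raddfD xy -(rmorph1 (val : A -> R)) phiK.
- by rewrite -!phiMr E.
- by rewrite -!phiMr F.
Qed.
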